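(* Let $n,m\ge1$, let $D_1,\dots,D_n\in\mathbf R^{m\times m}$, and let $D^{[i]}$, $d_i$, $d_i'$, $E_i$, $e_i$ ($i=1,\dots,n$) be as defined in the context. Then: 1. For $i=1,2,\dots,n$, the reduced row-echelon form of $D^{[i]}$ is $$\mathrm{rref}(D^{[i]})=\begin{bmatrix}E_1&*&\cdots&*\\ &E_2&\cdots&*\\ &&\ddots&\vdots\\ &&&E_i\\ 0&0&\cdots&0\end{bmatrix},$$ where the column blocks have width $m$, the blocks below the $E_j$ are zero, the blocks $*$ are unspecified, and $E_1,\dots,E_i$ are the same matrices as those appearing in $\mathrm{rref}(D^{[n]})$. 2. $e_i=d_i'$ for $i=1,2,\dots,n$. 3. $\mathrm{im}(E_1^{\mathrm T})\subseteq\mathrm{im}(E_2^{\mathrm T})\subseteq\cdots\subseteq\mathrm{im}(E_n^{\mathrm T})$. 4. $d_1\le d_2-d_1\le d_3-d_2\le\cdots\le d_n-d_{n-1}$.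
   Context: For $i=1,\dots,n$, $D^{[i]}\in\mathbf R^{mi\times mi}$ is the block skew lower-triangular Hankel matrix $$D^{[i]}=\begin{bmatrix}&&&D_1\\ &&D_1&D_2\\ &\cdot^{\cdot^{\cdot}}&\cdot^{\cdot^{\cdot}}&\vdots\\ D_1&D_2&\cdots&D_i\end{bmatrix},$$ i.e. its $(j,k)$ block ($m\times m$, $1\le j,k\le i$) is $0$ if $j+k\le i$ and $D_{j+k-i}$ if $j+k\ge i+1$. Put $d_i=\mathrm{rank}(D^{[i]})$, $d_1'=d_1$ and $d_i'=d_i-d_{i-1}$ for $i\ge2$. The reduced row-echelon form (rref) of $D^{[n]}$, with columns divided into $n$ blocks of width $m$, is partitioned as $$\mathrm{rref}(D^{[n]})=\begin{bmatrix}E_1&*&\cdots&*\\ &E_2&\cdots&*\\ &&\ddots&\vdots\\ &&&E_n\\ 0&0&\cdots&0\end{bmatrix},$$ where $E_i\in\mathbf R^{e_i\times m}$ has full row rank $e_i\ge0$; that is, the $i$-th row block consists of the nonzero rows whose pivot lies in the $i$-th column block, and $E_i$ is the $i$-th column block of those rows. $E_i$ may be empty ($e_i=0$), in which case its row space is $\{0\}$. $\mathrm{im}(X^{\mathrm T})$ denotes the row space of $X$. *)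

(* Defs.v *)
From mathcomp Require Import all_boot all_order all_algebra.
From mathcomp Require Import boolp classical_sets reals.

Set Implicit Arguments.
Unset Strict Implicit.
Unset Printing Implicit Defensive.
Import Order.TTheory GRing.Theory Num.Theory.
Local Open Scope ring_scope.

Section ReducedRowEchelon.
Variables (F : fieldType) (p q : nat).
Implicit Types A B : 'M[F]_(p, q).

Definition is_pivot A (r : 'I_p) (c : 'I_q) : bool :=
  (A r c != 0) && [forall c' : 'I_q, (c' < c)%N ==> (A r c' == 0)].

Definition is_rref A : Prop :=
  [/\ forall r r' : 'I_p, (r < r')%N -> row r A = 0 -> row r' A = 0,
      forall (r r' : 'I_p) (c c' : 'I_q),
        (r < r')%N -> is_pivot A r c -> is_pivot A r' c' -> (c < c')%N,
      forall (r : 'I_p) (c : 'I_q), is_pivot A r c -> A r c = 1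
    & forall (r r' : 'I_p) (c : 'I_q),
        is_pivot A r c -> r' != r -> A r' c = 0].

Definition row_equiv A B : Prop :=
  exists2 P : 'M[F]_p, P \in unitmx & B = P *m A.

(* The row-equivalent matrix in reduced row-echelon form exists and is unique,
   so the default value 0 of xget plays no role. *)
Definition rref A : 'M[F]_(p, q) :=
  xget 0 (fun B => row_equiv A B /\ is_rref B).

End ReducedRowEchelon.

Section HankelBlocks.
Variables (F : fieldType) (m : nat).

(* The blocks D_1, D_2, ... are D 1, D 2, ...; D 0 is never used. The ordinals
   j, k count blocks from 0, so they stand for the block position
   (j.+1, k.+1). *)
Definition hankel (D : nat -> 'M[F]_m) (i : nat) :
    'M[F]_(\sum_(j < i) m, \sum_(k < i) m) :=
  \mxblock_(j < i, k < i)
    (if (j.+1 + k.+1 <= i)%N then 0 else D (j.+1 + k.+1 - i)%N).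

Definition hrank (D : nat -> 'M[F]_m) (i : nat) : nat := \rank (hankel D i).

(* Integer-valued, to avoid the truncated subtraction of nat. *)
Definition hrank_diff (D : nat -> 'M[F]_m) (i : nat) : int :=
  if i == 1%N then (hrank D 1)%:Z else (hrank D i)%:Z - (hrank D i.-1)%:Z.

(* tagnat.sig1 c is the index of the column block containing column c. *)
Definition pivot_rows (p n : nat) (A : 'M[F]_(p, \sum_(k < n) m)) (k : 'I_n) :
    {set 'I_p} :=
  [set r | [exists c, is_pivot A r c && (tagnat.sig1 c == k)]]%SET.

(* enum_val lists the selected rows in increasing order. *)
Definition pivot_block (p n : nat) (A : 'M[F]_(p, \sum_(k < n) m)) (k : 'I_n) :
    'M[F]_(#|pivot_rows A k|, m) :=
  rowsub (fun a : 'I_#|pivot_rows A k| => enum_val a) (submxrow A k).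

(* E_{k+1} and e_{k+1} for k : 'I_n. *)
Definition Erows (n : nat) (D : nat -> 'M[F]_m) (k : 'I_n) : nat :=
  #|pivot_rows (rref (hankel D n)) k|.

Definition Eblock (n : nat) (D : nat -> 'M[F]_m) (k : 'I_n) :
    'M[F]_(Erows D k, m) :=
  pivot_block (rref (hankel D n)) k.

(* A is block upper triangular with diagonal blocks E_0, ..., E_{i-1}, followed
   by z zero rows; the blocks above the diagonal are arbitrary. *)
Definition block_echelon (p i : nat) (A : 'M[F]_(p, \sum_(k < i) m))
    (e : 'I_i -> nat) (E : forall j : 'I_i, 'M[F]_(e j, m)) : Prop :=
  exists (z : nat) (hz : (\sum_(j < i) e j + z)%N = p)
         (B : forall j k : 'I_i, 'M[F]_(e j, m)),
  [/\ forall j : 'I_i, B j j = E j,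
      forall j k : 'I_i, (k < j)%N -> B j k = 0
    & A = castmx (hz, erefl)
            (col_mx (\mxblock_(j < i, k < i) B j k) (0 : 'M_(z, _)))].

End HankelBlocks.

(* Main.v *)
(* The reduced row-echelon form depends only on the row space: its pivot columns
   are the leading positions of the vectors of that space, and zero rows only pad
   it.  Dropping trailing columns preserves reducedness, and the first i column
   blocks of D^[n] are D^[i] below zero rows, so the first i column blocks of
   rref(D^[n]) are rref(D^[i]) up to zero rows.  Hence the pivots of the k-th
   block of rref(D^[n]) are those of the rows numbered d_(k-1), ..., d_k - 1.
   For the inclusion of row spaces, the first i row blocks of D^[i+1] are
   [0 D^[i]]: if (0, ..., 0, v) is in the row space of D^[i], then it is in that
   of D^[i+1] with one more zero block in front, where its coordinates on the
   rows of the rref are its entries at the pivots, so that only rows with pivot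
   in the last block contribute. *)
Require Import Defs.
From mathcomp Require Import all_boot all_order all_algebra.
From mathcomp Require Import boolp classical_sets reals.
From mathcomp Require Import zify.

Set Implicit Arguments.
Unset Strict Implicit.
Unset Printing Implicit Defensive.
Import Order.TTheory GRing.Theory Num.Theory.
Local Open Scope ring_scope.

(** * Increasing enumeration of sets of ordinals *)

Lemma card_ord_ltn p k : (k <= p)%N -> #|[set r : 'I_p | (r < k)%N]%SET| = k.
Proof.
move=> kp; have -> : [set r : 'I_p | (r < k)%N]%SET = (widen_ord kp @: [set: 'I_k])%SET.
  apply/setP => r; rewrite inE; apply/idP/imsetP => [rk|[s _ ->]] /=; last exact: ltn_ord.
  by exists (Ordinal rk); [rewrite inE | apply: ord_inj].
rewrite card_imset ?cardsT ?card_ord // => r s /(congr1 val) /= rs.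
exact: ord_inj.
Qed.

(** Compare cardinalities: a member [r] brings the [r.+1] ordinals up to it into [S], while a
    non-member bounds all of [S] strictly from above. *)
Lemma initial_segment p (S : {set 'I_p}) :
  (forall r r' : 'I_p, (r' < r)%N -> r \in S -> r' \in S) ->
  forall r : 'I_p, (r < #|S|)%N = (r \in S).
Proof.
move=> Sdown r; have lp := ltn_ord r.
case: (boolP (r \in S)) => rS.
  rewrite -[(r : nat).+1](@card_ord_ltn p) //; apply: subset_leq_card.
  apply/fintype.subsetP => s; rewrite inE ltnS leq_eqVlt => /orP[/eqP/ord_inj->//|sr].
  exact: Sdown rS.
apply/negbTE; rewrite -leqNgt -[(r : nat)](@card_ord_ltn p) ?(ltnW lp) //.
apply: subset_leq_card; apply/fintype.subsetP => s sS; rewrite inE ltnNge leq_eqVlt.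
apply/negP => /orP[/eqP/ord_inj rs|rs]; first by rewrite rs sS in rS.
by rewrite (Sdown _ _ rs sS) in rS.
Qed.

Lemma sorted_enum_ord p (S : {set 'I_p}) : sorted ltn [seq val i | i <- enum S].
Proof.
rewrite /enum_mem -enumT sorted_map; apply: sorted_filter.
  by move=> x y z; apply: ltn_trans.
by rewrite -sorted_map val_enum_ord iota_ltn_sorted.
Qed.

Lemma enum_val_ltn p (S : {set 'I_p}) (a b : 'I_#|S|) :
  (a < b)%N -> (enum_val a < enum_val b)%N.
Proof.
move=> ab; have ltS (i : 'I_#|S|) : (i < size (enum S))%N by rewrite -cardE.
rewrite !(enum_val_nth (enum_default a)).
rewrite -!(nth_map _ 0%N val) //.
have := sorted_ltn_nth ltn_trans 0%N (sorted_enum_ord S) (a : nat) (b : nat).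
by rewrite !inE size_map; apply.
Qed.

(** The enumeration of [S] and the interval are strictly increasing lists with the same members,
    hence equal; so [enum_val] is the shift by [lo]. *)
Lemma enum_val_interval p (S : {set 'I_p}) lo hi : (lo <= hi)%N -> (hi <= p)%N ->
  (forall r : 'I_p, (r \in S) = (lo <= r < hi)%N) ->
  #|S| = (hi - lo)%N /\ forall a : 'I_#|S|, enum_val a = (lo + a)%N :> nat.
Proof.
move=> lohi hip SE.
have enumE : [seq val i | i <- enum S] = iota lo (hi - lo).
  apply: (irr_sorted_eq ltn_trans ltnn); rewrite ?sorted_enum_ord ?iota_ltn_sorted //.
  move=> i; rewrite mem_iota subnKC //; apply/mapP/idP => [[r + ->]|li].
    by rewrite mem_enum SE.
  have ip : (i < p)%N by case/andP: li => _ /leq_trans->.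
  by exists (Ordinal ip); rewrite // mem_enum SE.
have cardS : #|S| = (hi - lo)%N by rewrite cardE -(size_map val) enumE size_iota.
split=> // a; rewrite (enum_val_nth (enum_default a)) -(nth_map _ 0%N val).
  by rewrite enumE nth_iota // -cardS.
by rewrite -cardE.
Qed.

(** * Pivots, row spaces and uniqueness of the reduced form *)

Section Pivots.
Variables (F : fieldType) (q : nat).

Lemma pivotP p (A : 'M[F]_(p, q)) r c :
  reflect (A r c != 0 /\ forall c' : 'I_q, (c' < c)%N -> A r c' = 0)
          (is_pivot A r c).
Proof.
apply: (iffP andP) => -[h1 h2]; split=> //.
  by move=> c' c'c; apply/eqP; exact: (implyP (forallP h2 c')).
by apply/forallP => c'; apply/implyP => /h2 ->.
Qed.

Lemma pivot_row p (A : 'M[F]_(p, q)) r c :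
  is_pivot (row r A) 0 c = is_pivot A r c.
Proof.
by rewrite /is_pivot mxE; congr andb; apply: eq_forallb => c'; rewrite mxE.
Qed.

Lemma row_neq0_pivot p (A : 'M[F]_(p, q)) r :
  (row r A != 0) = [exists c, is_pivot A r c].
Proof.
apply/idP/existsP => [/rV0Pn[c0 nz]|[c /pivotP[nz _]]]; last first.
  by apply/rV0Pn; exists c; rewrite mxE.
rewrite mxE in nz.
have [c nzc cmin] := @arg_minnP _ c0 (fun c => A r c != 0) val nz.
exists c; apply/pivotP; split=> // c' c'c; apply/eqP/negPn/negP => /cmin.
by rewrite leqNgt c'c.
Qed.

Lemma pivot_inj p (A : 'M[F]_(p, q)) r c c' :
  is_pivot A r c -> is_pivot A r c' -> c = c'.
Proof.
move=> /pivotP[nz lt0] /pivotP[nz' lt0'].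
case: (ltngtP c c') => [cc'|cc'|/ord_inj//].
  by rewrite lt0' ?eqxx in nz.
by rewrite lt0 ?eqxx in nz'.
Qed.

Lemma rank_colsub1 p (U : 'M[F]_(p, q)) (g : 'I_p -> 'I_q) :
  colsub g U = 1%:M -> \rank U = p.
Proof.
move=> UgE; apply/eqP; rewrite eqn_leq rank_leq_row /= -[leqLHS](mxrank1 F) -UgE.
by rewrite -[U in colsub g U]mulmx1 -mulmx_colsub mxrankM_maxl.
Qed.

Section Rref.
Variables (p : nat) (A : 'M[F]_(p, q)).
Hypothesis rA : is_rref A.

Lemma rref_pivot_col r c : is_pivot A r c -> forall r', A r' c = (r' == r)%:R.
Proof.
case: rA => _ _ one zero pc r'; case: eqVneq => [->|]; first exact: one.
exact: zero.
Qed.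

(** A pivot column is a unit vector, so the coefficients of a combination of rows can be read off at
    the pivots. *)
Lemma rref_coord (u : 'rV_p) r c : is_pivot A r c -> (u *m A) 0 c = u 0 r.
Proof.
move=> /rref_pivot_col Ac; rewrite mxE (bigD1 r) //= Ac eqxx mulr1 big1 ?addr0 //.
by move=> i /negbTE ir; rewrite Ac ir mulr0.
Qed.

Lemma rref_pivot_ltn (r r' : 'I_p) c :
  (r' < r)%N -> is_pivot A r c -> exists2 c' : 'I_q, (c' < c)%N & is_pivot A r' c'.
Proof.
case: rA => zero incr _ _ r'r pc.
suff: row r' A != 0.
  rewrite row_neq0_pivot => /existsP[c' pc']; exists c' => //.
  exact: incr pc' pc.
apply/eqP => /(zero _ _ r'r)/eqP; apply/negP.
by rewrite row_neq0_pivot; apply/existsP; exists c.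
Qed.

(** Some row with nonzero coefficient is nonzero at [c]. Its pivot cannot come after [c]; nor can it
    come before, since [w] would show that coefficient there, yet [w] vanishes before [c]. *)
Lemma rref_rowspace_pivot (w : 'rV_q) c :
  (w <= A)%MS -> is_pivot w 0 c -> exists r, is_pivot A r c.
Proof.
case/submxP => u -> /pivotP[]; rewrite mxE => nz lt0.
have [r /= nzr] : exists r, u 0 r * A r c != 0.
  apply/existsP; rewrite -negb_forall; apply: contraNN nz => /forallP h.
  by rewrite big1 // => r _; apply/eqP.
have: row r A != 0.
  apply/rV0Pn; exists c; rewrite mxE.
  by apply: contraNneq nzr => ->; rewrite mulr0.
rewrite row_neq0_pivot => /existsP[c' pc'].
suff -> : c = c' by exists r.
have /pivotP[_ lt0'] := pc'; case: (ltngtP c c') => [cc'|c'c|/ord_inj//].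
  by rewrite lt0' // mulr0 eqxx in nzr.
by move/eqP: nzr; rewrite -(rref_coord u pc') lt0 // mul0r.
Qed.

(** Rows above [r] correspond bijectively to pivot columns left of [c]. Hence the set of pivot
    columns alone determines which row has a given pivot. *)
Lemma rref_row_index r c : is_pivot A r c ->
  #|[set c' : 'I_q | (c' < c)%N && [exists r', is_pivot A r' c']]%SET| = r.
Proof.
move=> pc; pose f r' := if [pick c' | is_pivot A r' c'] is Some c' then c' else c.
have fE r' c' : is_pivot A r' c' -> f r' = c'.
  rewrite /f; case: pickP => [d pd pc'|/(_ c')->//].
  exact: pivot_inj pd pc'.
have incr : forall (r r' : 'I_p) (c c' : 'I_q),
  (r < r')%N -> is_pivot A r c -> is_pivot A r' c' -> (c < c')%N by case: rA.
have -> : [set c' : 'I_q | (c' < c)%N && [exists r', is_pivot A r' c']]%SET =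
          (f @: [set r' : 'I_p | (r' < r)%N])%SET.
  apply/setP => d; rewrite inE; apply/andP/imsetP => [[dc /existsP[r' pd]]|].
    exists r'; rewrite ?(fE _ _ pd) // inE ltnNge leq_eqVlt; apply/negP.
    case/orP=> [/eqP/ord_inj rr'|rr'].
      by rewrite -rr' in pd; rewrite (pivot_inj pd pc) ltnn in dc.
    by rewrite ltnNge ltnW ?(incr _ _ _ _ rr' pc pd) in dc.
  case=> r'; rewrite inE => r'r ->.
  have [c' c'c pc'] := rref_pivot_ltn r'r pc; rewrite (fE _ _ pc'); split=> //.
  by apply/existsP; exists r'.
rewrite card_in_imset ?card_ord_ltn // ?(ltnW (ltn_ord r)) //.
move=> s t; rewrite !inE => /(rref_pivot_ltn)/(_ pc)[d dc pd].
move=> /(rref_pivot_ltn)/(_ pc)[e ec pe]; rewrite (fE _ _ pd) (fE _ _ pe) => de.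
case: (ltngtP s t) => [st|ts|/ord_inj//].
  by have := incr _ _ _ _ st pd pe; rewrite de ltnn.
by have := incr _ _ _ _ ts pe pd; rewrite de ltnn.
Qed.

(** The nonzero rows contain an identity matrix at their pivot columns, so their number is the rank;
    since zero rows come last, they form an initial segment. *)
Lemma rref_ltn_rank (r : 'I_p) :
  (r < \rank A)%N = [exists c, is_pivot A r c].
Proof.
pose S := [set r | [exists c, is_pivot A r c]]%SET.
have -> : \rank A = #|S|.
  pose U := rowsub (fun a : 'I_#|S| => enum_val a) A.
  have piv (a : 'I_#|S|) : {c | is_pivot A (enum_val a) c}.
    by apply/sigW; have := enum_valP a; rewrite inE => /existsP.
  have UA : (A == U)%MS.
    rewrite rowsub_sub andbT; apply/row_subP => s.
    have [->|nz] := eqVneq (row s A) 0; first exact: sub0mx.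
    have sS : s \in S by rewrite inE -row_neq0_pivot.
    have -> : row s A = row (enum_rank_in sS s) U.
      by apply/rowP => c; rewrite !mxE enum_rankK_in.
    exact: row_sub.
  rewrite (eqmx_rank UA); apply: (rank_colsub1 (g := fun a => sval (piv a))).
  apply/matrixP => a b; rewrite !mxE (rref_pivot_col (svalP (piv b))).
  by rewrite (inj_eq enum_val_inj).
rewrite initial_segment ?inE // => s s' s's; rewrite !inE => /existsP[c pc].
by have [d _ pd] := rref_pivot_ltn s's pc; apply/existsP; exists d.
Qed.

End Rref.

(** Equal row spaces have the same leading positions, hence the same pivot columns and row numbers.
    The difference of the two rows vanishes at every pivot column, whereas a nonzero vector of the
    row space leads at one. *)
Lemma rref_rows p1 p2 (A : 'M[F]_(p1, q)) (B : 'M[F]_(p2, q)) r c :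
  is_rref A -> is_rref B -> (A :=: B)%MS -> is_pivot A r c ->
  exists2 r' : 'I_p2, r' = r :> nat & row r' B = row r A.
Proof.
move=> rA rB AB pc.
have pivAB d : [exists s, is_pivot A s d] = [exists s, is_pivot B s d].
  apply/existsP/existsP => -[s ps].
    by apply: (rref_rowspace_pivot rB (w := row s A)); rewrite ?pivot_row // -AB row_sub.
  by apply: (rref_rowspace_pivot rA (w := row s B)); rewrite ?pivot_row // AB row_sub.
have /existsP[r' pc'] : [exists s, is_pivot B s c].
  by rewrite -pivAB; apply/existsP; exists r.
exists r'.
  rewrite -(rref_row_index rA pc) -(rref_row_index rB pc').
  by apply: eq_card => d; rewrite !inE pivAB.
apply/esym/eqP; rewrite -subr_eq0; apply/negPn/negP => nz.
have wB : (row r A - row r' B <= B)%MS.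
  by rewrite addmx_sub ?eqmx_opp ?row_sub // -AB row_sub.
have /existsP[d pd] : [exists d, is_pivot (row r A - row r' B) 0 d].
  by rewrite -row_neq0_pivot row_id.
have [s ps] := rref_rowspace_pivot rB wB pd.
have /existsP[t pt] : [exists t, is_pivot A t d].
  by rewrite pivAB; apply/existsP; exists s.
case/pivotP: pd => + _; rewrite !mxE; have [<-|cd] := eqVneq c d.
  by rewrite (rref_pivot_col rA pc) (rref_pivot_col rB pc') !eqxx subrr eqxx.
rewrite (rref_pivot_col rA pt) (rref_pivot_col rB ps).
have -> : (r == t) = false.
  by apply: contraNF cd => /eqP rt; rewrite -rt in pt; rewrite (pivot_inj pc pt).
have -> : (r' == s) = false.
  by apply: contraNF cd => /eqP rt; rewrite -rt in ps; rewrite (pivot_inj pc' ps).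
by rewrite subrr eqxx.
Qed.

Lemma rref_row_eq p1 p2 (A : 'M[F]_(p1, q)) (B : 'M[F]_(p2, q))
    (r : 'I_p1) (r' : 'I_p2) :
  is_rref A -> is_rref B -> (A :=: B)%MS -> r = r' :> nat -> row r A = row r' B.
Proof.
move=> rA rB AB rr'; have [Ar0|] := eqVneq (row r A) 0; last first.
  rewrite row_neq0_pivot => /existsP[c /(rref_rows rA rB AB)[s sr <-]].
  by congr row; apply: ord_inj; rewrite sr.
have [->//|] := eqVneq (row r' B) 0.
rewrite row_neq0_pivot => /existsP[c /(rref_rows rB rA (eqmx_sym AB))[s sr <-]].
by congr row; apply: ord_inj; rewrite sr.
Qed.

End Pivots.

(** * Existence of the reduced form *)

Section Existence.
Variable F : fieldType.

(* [S] is the set of leading positions of vectors of the row space. Vectors of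
   the row space leading at the positions in [S] restrict to an invertible
   triangular matrix [T] on [S]; multiplying by its inverse gives the nonzero
   rows, whose leading position lies in [S] and hence cannot have moved. *)
Lemma rref_exists p q (A : 'M[F]_(p, q)) :
  exists B : 'M[F]_(p, q), row_equiv A B /\ is_rref B.
Proof.
pose S := [set c | `[< exists2 w : 'rV_q, (w <= A)%MS & is_pivot w 0 c >]]%SET.
pose s (a : 'I_#|S|) : 'I_q := enum_val a.
have sP a : {w : 'rV_q | (w <= A)%MS /\ is_pivot w 0 (s a)}.
  by apply: cid; have := enum_valP a; rewrite inE => /asboolP[w ? ?]; exists w.
pose U := \matrix_(a, c) sval (sP a) 0 c.
have UA : (U <= A)%MS.
  by apply/row_subP => a; rewrite rowK; case: (svalP (sP a)) => + _; congr (_ <= _)%MS.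
pose T := colsub s U.
have Tu : T \in unitmx.
  rewrite unitmxE -det_tr det_trig; last first.
    apply/is_trig_mxP => a b ab; rewrite !mxE.
    by have [_ /pivotP[_ ->//]] := svalP (sP b); exact: enum_val_ltn.
  rewrite unitfE; apply/prodf_neq0 => a _; rewrite !mxE.
  by have [_ /pivotP[]] := svalP (sP a).
have [V VA Vs] : exists2 V : 'M_(#|S|, q), (V <= A)%MS &
    forall a b, V a (s b) = (a == b)%:R.
  exists (invmx T *m U); first by rewrite mulmx_sub.
  have : colsub s (invmx T *m U) = 1%:M by rewrite -mulmx_colsub mulVmx.
  by move=> + a b => /matrixP/(_ a b); rewrite [LHS]mxE => ->; rewrite mxE.
have S0 (w : 'rV_q) : (w <= A)%MS -> (forall b, w 0 (s b) = 0) -> w = 0.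
  move=> wA w0; apply/eqP/negPn/negP; rewrite -[w](row_id 0).
  rewrite row_neq0_pivot => /existsP[c pc].
  have cS : c \in S by rewrite inE; apply/asboolP; exists w.
  by have /pivotP[] := pc; rewrite -(enum_rankK_in cS cS) w0 eqxx.
have AV : (A <= V)%MS.
  apply/row_subP => r; suff -> : row r A = colsub s (row r A) *m V by exact: submxMl.
  apply/eqP; rewrite -subr_eq0; apply/eqP/S0.
    by rewrite addmx_sub ?eqmx_opp ?row_sub // mulmx_sub.
  move=> b; rewrite !mxE (bigD1 b) //= Vs eqxx mulr1 !mxE big1 ?addr0 ?subrr //.
  by move=> i /negbTE ib; rewrite Vs ib mulr0.
have pivV a : is_pivot V a (s a).
  have : row a V != 0.
    by apply/rV0Pn; exists (s a); rewrite mxE Vs eqxx oner_eq0.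
  rewrite row_neq0_pivot => /existsP[c pc].
  have cS : c \in S.
    rewrite inE; apply/asboolP; exists (row a V); last by rewrite pivot_row.
    by rewrite (submx_trans _ VA) ?row_sub.
  move: pc; rewrite -(enum_rankK_in cS cS) -/(s _) => pc; case/pivotP: (pc) => + _.
  rewrite Vs; have [e _|_ /eqP //] := eqVneq a (enum_rank_in cS c).
  by rewrite -e in pc.
have Sp : (#|S| <= p)%N.
  apply: leq_trans (rank_leq_row A); rewrite -[leqLHS](mxrank1 F).
  have -> : 1%:M = colsub s V by apply/matrixP => a b; rewrite !mxE Vs.
  rewrite -[V]mulmx1 -mulmx_colsub.
  by apply: leq_trans (mxrankM_maxl _ _) (mxrankS VA).
(* The rows of [V] come first; from row [#|S|] on, [insub] fails and zero rows pad the matrix. *)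
pose B := \matrix_(r < p, c < q)
  (if insub (r : nat) is Some a then V a c else 0).
have BV (r : 'I_p) (a : 'I_#|S|) : a = r :> nat -> row r B = row a V.
  move=> ar; apply/rowP => c; rewrite !mxE; case: insubP => [b _ br|].
    by congr (V _ c); apply: ord_inj; rewrite ar.
  by rewrite -ar ltn_ord.
have B0 (r : 'I_p) : (#|S| <= r)%N -> row r B = 0.
  move=> Sr; apply/rowP => c; rewrite !mxE; case: insubP => // b.
  by rewrite ltnNge Sr.
have pivB r c : is_pivot B r c -> exists2 a : 'I_#|S|, a = r :> nat & c = s a.
  case: (ltnP r #|S|) => [rS|Sr]; last first.
    by rewrite -pivot_row B0 // => /pivotP[]; rewrite mxE eqxx.
  rewrite -pivot_row (BV r (Ordinal rS)) // pivot_row => pc.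
  by exists (Ordinal rS); rewrite // (pivot_inj pc (pivV _)).
have BE (r : 'I_p) (a : 'I_#|S|) c : a = r :> nat -> B r c = V a c.
  by move=> /BV/rowP/(_ c); rewrite !mxE.
(* Matrices of the same shape with equal row spaces are row equivalent, so two inclusions
   suffice. *)
exists B; split; first (apply/eqmxMunitP/andP; split).
- apply/row_subP => r; case: (ltnP r #|S|) => [rS|/B0->]; last exact: sub0mx.
  by rewrite (BV r (Ordinal rS)) // (submx_trans _ VA) ?row_sub.
- apply: (submx_trans AV); apply/row_subP => a.
  by rewrite -(BV (widen_ord Sp a)) ?row_sub.
split=> [r r' rr' | r r' c c' rr' /pivB[a ar ->] /pivB[a' ar' ->] | r c /pivB[a ar ->] | ].
- case: (ltnP r #|S|) => [rS|Sr _].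
    rewrite (BV r (Ordinal rS)) // => /rowP/(_ (s (Ordinal rS))).
    by rewrite !mxE Vs eqxx => /eqP; rewrite oner_eq0.
  by apply: B0; apply: leq_trans (ltnW rr').
- by apply: enum_val_ltn; rewrite ar ar'.
- by rewrite (BE r a) // Vs eqxx.
move=> r r' c /pivB[a ar ->] r'r; case: (ltnP r' #|S|) => [rS|/B0/rowP/(_ (s a))].
  rewrite (BE r' (Ordinal rS)) // Vs; case: eqVneq => // ra.
  by case/eqP: r'r; apply: ord_inj; rewrite -ar -ra.
by rewrite !mxE.
Qed.

Lemma rrefP p q (A : 'M[F]_(p, q)) : is_rref (rref A) /\ (rref A :=: A)%MS.
Proof.
by have [/eqmxMunitP/eqmxP AB ?] := xgetPex 0 (rref_exists A).
Qed.

(** * Dropping trailing columns *)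

Section LeadingColumns.
Variables (p q q' : nat) (le_q : (q <= q')%N) (A : 'M[F]_(p, q')).

Lemma pivot_leading r c :
  is_pivot (colsub (widen_ord le_q) A) r c = is_pivot A r (widen_ord le_q c).
Proof.
apply/pivotP/pivotP; rewrite mxE => -[nz lt0]; split=> // c' c'c.
  have c'q : (c' < q)%N by exact: ltn_trans (ltn_ord c).
  rewrite -(lt0 (Ordinal c'q)) // mxE; congr (A r _); exact: ord_inj.
by rewrite mxE lt0.
Qed.

(** If a row has its pivot among the kept columns, every earlier row has its pivot further left,
    hence also among them; so zero rows remain last. *)
Lemma rref_leading : is_rref A -> is_rref (colsub (widen_ord le_q) A).
Proof.
move=> rA; have [_ incr one zero] := rA; split.
- move=> r r' rr' /eqP r0; apply/eqP; move: r0; apply: contraTT.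
  rewrite !row_neq0_pivot => /existsP[c]; rewrite pivot_leading => pc.
  have [d /= dc pd] := rref_pivot_ltn rA rr' pc.
  have dq : (d < q)%N by exact: ltn_trans (ltn_ord c).
  apply/existsP; exists (Ordinal dq); rewrite pivot_leading.
  by rewrite (_ : widen_ord _ _ = d) //; apply: ord_inj.
- by move=> r r' c c' rr'; rewrite !pivot_leading; apply: incr.
- by move=> r c; rewrite pivot_leading mxE => /one.
by move=> r r' c; rewrite pivot_leading mxE => /zero; apply.
Qed.

End LeadingColumns.
End Existence.

(* [mxE] restricted to one shape: it would also unfold [hankel]. *)
Lemma row_entry (T : Type) p q (A : 'M[T]_(p, q)) r c : row r A 0 c = A r c.
Proof. exact: mxE. Qed.

Lemma mxsub_entry (T : Type) p q p' q' (f : 'I_p' -> 'I_p) (g : 'I_q' -> 'I_q)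
  (A : 'M[T]_(p, q)) r c : mxsub f g A r c = A (f r) (g c).
Proof. exact: mxE. Qed.

Lemma val_widen p q (h : (p <= q)%N) (i : 'I_p) : widen_ord h i = i :> nat.
Proof. by []. Qed.

(** * Block coordinates and Hankel matrices *)

Section BlockHankel.
Variables (F : fieldType) (m : nat).
Implicit Types D : nat -> 'M[F]_m.

Lemma sum_block n : (\sum_(k < n) m = n * m)%N.
Proof. by rewrite sum_nat_const card_ord. Qed.

Lemma leq_block i n : (i <= n)%N -> (\sum_(k < i) m <= \sum_(k < n) m)%N.
Proof. by rewrite !sum_block => /leq_mul->. Qed.

Lemma Rank_block n (k : 'I_n) (b : 'I_m) :
  tagnat.Rank (p_ := fun=> m) k b = (k * m + b)%N :> nat.
Proof.
rewrite tagnat.RankEsum sum_nat_cond_const; congr (_ * _ + _)%N.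
by rewrite -[RHS](card_ord_ltn (ltnW (ltn_ord k))); apply: eq_card => i; rewrite !inE.
Qed.

Lemma block_ind n (P : 'I_(\sum_(k < n) m) -> Prop) :
  (forall k b, P (tagnat.Rank (p_ := fun=> m) k b)) -> forall c, P c.
Proof. by move=> PR c; rewrite -(tagnat.sig2K c). Qed.

Lemma sig1_ltn n i (c : 'I_(\sum_(k < n) m)) :
  (tagnat.sig1 c < i)%N = (c < \sum_(k < i) m)%N.
Proof.
elim/block_ind: c => k b; rewrite tagnat.Rank1K Rank_block sum_block.
have mb := ltn_ord b; apply/idP/idP => [ki|].
  by apply: leq_trans (leq_mul ki (leqnn m)); rewrite mulSn addnC ltn_add2r.
apply: contraTT; rewrite -!leqNgt => ik.
by apply: leq_trans (leq_mul ik (leqnn m)) _; rewrite leq_addr.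
Qed.

Lemma sig1_widen i n (le_in : (i <= n)%N) (c : 'I_(\sum_(k < i) m)) :
  tagnat.sig1 (widen_ord (leq_block le_in) c) = tagnat.sig1 c :> nat.
Proof.
elim/block_ind: c => k b; rewrite tagnat.Rank1K.
have -> : widen_ord (leq_block le_in) (tagnat.Rank (p_ := fun=> m) k b) =
          tagnat.Rank (p_ := fun=> m) (widen_ord le_in k) b.
  by apply: ord_inj; rewrite val_widen !Rank_block.
by rewrite tagnat.Rank1K.
Qed.

(** Block positions are plain numbers, so that entries of Hankel matrices of different sizes can be
    compared. *)
Lemma hankelE D i (r c : 'I_(\sum_(k < i) m)) (j k : nat) (a b : 'I_m) :
  r = (j * m + a)%N :> nat -> c = (k * m + b)%N :> nat ->
  hankel D i r c = if (j.+1 + k.+1 <= i)%N then 0 else D (j.+1 + k.+1 - i)%N a b.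
Proof.
have coordE (x y : nat) (s t : 'I_m) : (x * m + s = y * m + t)%N -> x = y /\ s = t.
  move=> e; have m0 : (0 < m)%N by exact: leq_trans (ltn_ord s).
  have xy : x = y.
    by have := congr1 (divn^~ m) e; rewrite /= !divnMDl // !divn_small // !addn0.
  by split=> //; apply: ord_inj; move: e; rewrite xy => /addnI.
elim/block_ind: r => j' a'; elim/block_ind: c => k' b'.
rewrite !Rank_block => /coordE[<- <-] /coordE[<- <-].
have /matrixP/(_ a' b') := mxblockK (p_ := fun=> m) (q_ := fun=> m)
  (fun j k : 'I_i => if (j.+1 + k.+1 <= i)%N then 0 else D (j.+1 + k.+1 - i)%N) j' k'.
by rewrite mxE => ->; case: ifP => // _; rewrite mxE.
Qed.

(** A block depends only on the sum of its indices minus the size: row block [j] of the truncation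
    is zero for [j < n - i], and otherwise is row block [j - (n - i)] of [hankel D i]. *)
Lemma hankel_leading D i n (le_in : (i <= n)%N) :
  (colsub (widen_ord (leq_block le_in)) (hankel D n) :=: hankel D i)%MS.
Proof.
apply/eqmxP/andP; split; apply/row_subP; elim/block_ind => j a.
  case: (ltnP j (n - i)) => jni.
    suff -> : row (tagnat.Rank j a) (colsub (widen_ord (leq_block le_in)) (hankel D n)) = 0.
      exact: sub0mx.
    apply/rowP; elim/block_ind => k b; rewrite row_entry mxsub_entry [RHS]mxE.
    rewrite (hankelE D (j := j) (k := k) (a := a) (b := b)) ?val_widen ?Rank_block //.
    by rewrite ifT //; have := ltn_ord k; lia.
  have ji : (j - (n - i) < i)%N by have := ltn_ord j; lia.
  suff -> : row (tagnat.Rank j a) (colsub (widen_ord (leq_block le_in)) (hankel D n))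
    = row (tagnat.Rank (p_ := fun=> m) (Ordinal ji) a) (hankel D i) by exact: row_sub.
  apply/rowP; elim/block_ind => k b; rewrite !row_entry mxsub_entry.
  rewrite (hankelE D (j := j) (k := k) (a := a) (b := b)) ?val_widen ?Rank_block //.
  rewrite (hankelE D (j := j - (n - i)) (k := k) (a := a) (b := b)) ?val_widen ?Rank_block //.
  have -> : (j.+1 + k.+1 <= n = ((j - (n - i)).+1 + k.+1 <= i))%N by lia.
  by have -> : (j.+1 + k.+1 - n = (j - (n - i)).+1 + k.+1 - i)%N by lia.
have jn : (j + (n - i) < n)%N by have := ltn_ord j; lia.
suff -> : row (tagnat.Rank j a) (hankel D i)
  = row (tagnat.Rank (p_ := fun=> m) (Ordinal jn) a)
        (colsub (widen_ord (leq_block le_in)) (hankel D n)) by exact: row_sub.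
apply/rowP; elim/block_ind => k b; rewrite !row_entry mxsub_entry.
rewrite (hankelE D (i := i) (j := j) (k := k) (a := a) (b := b)) ?val_widen ?Rank_block //.
rewrite (hankelE D (j := j + (n - i)) (k := k) (a := a) (b := b)) ?val_widen ?Rank_block //.
have -> : (j.+1 + k.+1 <= i = ((j + (n - i)).+1 + k.+1 <= n))%N by lia.
by have -> : (j.+1 + k.+1 - i = (j + (n - i)).+1 + k.+1 - n)%N by lia.
Qed.

(* [w'] is [w] with a block of zeros put in front. *)
Lemma hankel_shift D i (w : 'rV_(\sum_(k < i) m)) : (w <= hankel D i)%MS ->
  exists2 w' : 'rV_(\sum_(k < i.+1) m), (w' <= hankel D i.+1)%MS &
    (forall c' : 'I_(\sum_(k < i.+1) m), (c' < m)%N -> w' 0 c' = 0) /\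
    (forall (c : 'I_(\sum_(k < i) m)) (c' : 'I_(\sum_(k < i.+1) m)),
       c' = (m + c)%N :> nat -> w' 0 c' = w 0 c).
Proof.
case/submxP=> u ->.
exists (u *m rowsub (widen_ord (leq_block (leqnSn i))) (hankel D i.+1)).
  by rewrite mulmx_sub // rowsub_sub.
split=> [c' c'm|c c'].
  rewrite mxE big1 // => + _; elim/block_ind => j a; rewrite mxsub_entry.
  rewrite (hankelE D (j := j) (k := 0) (a := a) (b := Ordinal c'm)) ?val_widen ?Rank_block //.
  by rewrite ifT ?mulr0 //; have := ltn_ord j; lia.
elim/block_ind: c => k b; rewrite Rank_block => c'E.
rewrite [LHS]mxE [RHS]mxE; apply: eq_bigr; elim/block_ind => j a _; congr (_ * _).
rewrite mxsub_entry.
rewrite (hankelE D (i := i) (j := j) (k := k) (a := a) (b := b)) ?val_widen ?Rank_block //.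
rewrite (hankelE D (i := i.+1) (j := j) (k := k.+1) (a := a) (b := b)) ?val_widen ?Rank_block //.
  by rewrite addnS subSS.
by rewrite c'E mulSn addnA.
Qed.

End BlockHankel.

(** * Row blocks of the reduced Hankel matrix *)

Section HankelRref.
Variables (F : fieldType) (m n : nat) (D : nat -> 'M[F]_m).
Notation N := (rref (hankel D n)).

Lemma rref_hankel_leading i (le_in : (i <= n)%N) :
  is_rref (colsub (widen_ord (leq_block m le_in)) N) /\
  (colsub (widen_ord (leq_block m le_in)) N :=: hankel D i)%MS.
Proof.
have [rN NE] := rrefP (hankel D n); split; first exact: rref_leading.
apply: eqmx_trans (hankel_leading D le_in).
rewrite -[N]mulmx1 -[X in (_ :=: colsub _ X)%MS]mulmx1 -!mulmx_colsub.
exact: eqmxMr.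
Qed.

Lemma rref_hankel_row i (le_in : (i <= n)%N) (r : 'I_(\sum_(k < i) m))
    (r' : 'I_(\sum_(k < n) m)) : r = r' :> nat ->
  row r (rref (hankel D i)) = row r' (colsub (widen_ord (leq_block m le_in)) N).
Proof.
have [rM ME] := rref_hankel_leading le_in; have [rA AE] := rrefP (hankel D i).
by apply: rref_row_eq => //; apply: eqmx_trans AE (eqmx_sym ME).
Qed.

(** The truncation of [N] to [i] column blocks has rank [hrank D i], and its pivots are those of [N]
    in these blocks. *)
Lemma ltn_hrank i (r : 'I_(\sum_(k < n) m)) : (i <= n)%N ->
  (r < hrank D i)%N = [exists c, is_pivot N r c && (tagnat.sig1 c < i)%N].
Proof.
move=> le_in; have [rM ME] := rref_hankel_leading le_in.
rewrite /hrank -ME rref_ltn_rank //.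
apply/existsP/existsP => -[c].
  by rewrite pivot_leading => pc; exists (widen_ord (leq_block m le_in) c);
     rewrite pc sig1_ltn /=.
rewrite sig1_ltn => /andP[pc ci]; exists (Ordinal ci); rewrite pivot_leading.
by rewrite (_ : widen_ord _ _ = c) //; apply: ord_inj.
Qed.

Lemma hrank_leq i : (hrank D i <= i * m)%N.
Proof. by rewrite -sum_block rank_leq_row. Qed.

Lemma hrank0 : hrank D 0 = 0%N.
Proof. by apply/eqP; rewrite -leqn0 hrank_leq. Qed.

Lemma hrank_leqS i : (hrank D i <= hrank D i.+1)%N.
Proof.
rewrite /hrank -(hankel_leading D (leqnSn i)) -[X in colsub _ X]mulmx1 -mulmx_colsub.
exact: mxrankM_maxl.
Qed.

(** A pivot lies in block [k] when it lies in the first [k.+1] blocks but not in the first [k];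
    [ltn_hrank] turns both conditions into bounds on [r]. *)
Lemma mem_pivot_rows (k : 'I_n) (r : 'I_(\sum_(k < n) m)) :
  (r \in pivot_rows N k) = (hrank D k <= r < hrank D k.+1)%N.
Proof.
rewrite leqNgt !ltn_hrank ?(ltnW (ltn_ord k)) // inE.
apply/existsP/andP => [[c /andP[pc /eqP ck]]|[nlt /existsP[c /andP[pc]]]].
  split; last by apply/existsP; exists c; rewrite pc ck /=.
  by apply/existsP => -[d /andP[/(pivot_inj pc)<-]]; rewrite ck ltnn.
rewrite ltnS leq_eqVlt => /orP[/eqP/ord_inj ck|ck].
  by exists c; rewrite pc ck eqxx.
by case/existsP: nlt; exists c; rewrite pc.
Qed.

Lemma pivot_rows_interval (k : 'I_n) : Erows D k = (hrank D k.+1 - hrank D k)%N /\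
  forall a : 'I_(Erows D k), enum_val a = (hrank D k + a)%N :> nat.
Proof.
apply: enum_val_interval (mem_pivot_rows k); first exact: hrank_leqS.
apply: leq_trans (hrank_leq _) _.
by rewrite -sum_block; apply: leq_block.
Qed.

(** The heights telescope. For [j < i] the sum counts the rows above row block [j]; for [j = i] it
    counts all nonzero rows. *)
Lemma sum_Erows i j (le_in : (i <= n)%N) : (j <= i)%N ->
  (\sum_(k < i | (k < j)%N) Erows D (widen_ord le_in k) = hrank D j)%N.
Proof.
move=> ji; transitivity (hrank D j - hrank D 0)%N; last by rewrite hrank0 subn0.
rewrite -telescope_sumn_in //; last first.
  by move=> k _; apply: hrank_leqS.
rewrite big_mkord (big_ord_widen _ (fun k => hrank D k.+1 - hrank D k)%N ji).
by apply: eq_bigr => k _; have [] := pivot_rows_interval (widen_ord le_in k).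
Qed.

Lemma rref_hankel_echelon i (le_in : (i <= n)%N) :
  block_echelon (rref (hankel D i)) (fun j : 'I_i => Eblock D (widen_ord le_in j)).
Proof.
have sumE : (\sum_(j < i) Erows D (widen_ord le_in j) = hrank D i)%N.
  by rewrite -(sum_Erows le_in (leqnn i)); apply: eq_bigl => k; rewrite ltn_ord.
exists (\sum_(j < i) m - hrank D i)%N.
have hz : (\sum_(j < i) Erows D (widen_ord le_in j) + (\sum_(j < i) m - hrank D i)
           = \sum_(j < i) m)%N.
  by rewrite sumE subnKC // rank_leq_row.
exists hz.
(* Row block [j] takes all its column blocks from [N], which also fixes the blocks above the
   diagonal. *)
exists (fun j k => rowsub (fun a : 'I_(Erows D (widen_ord le_in j)) => enum_val a)
                     (submxrow N (widen_ord le_in k))).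
have [rA AE] := rrefP (hankel D i).
split=> // [j k kj|].
  apply/matrixP => a b; rewrite !mxsub_entry [RHS]mxE.
  have := enum_valP a; rewrite inE => /existsP[c /andP[/pivotP[_ lt0] /eqP cj]].
  apply: lt0; apply: (@leq_trans (\sum_(k < j) m)%N).
    by rewrite -sig1_ltn tagnat.Rank1K.
  by rewrite leqNgt -sig1_ltn cj ltnn.
apply/matrixP => r c; rewrite castmxE cast_ord_id.
have rE : r = cast_ord (esym hz) r :> nat by [].
case: (split_ordP (cast_ord (esym hz) r)) => s sE; rewrite sE /= in rE *.
  rewrite col_mxEu [RHS]mxE !mxsub_entry.
  (* By [sum_Erows], the rows above a row block number exactly the offset at which [enum_val]
     starts, so the local row [tagnat.sig2 s] is row [r] of [N]. *)
  have [_ /(_ (tagnat.sig2 s)) vE] := pivot_rows_interval (widen_ord le_in (tagnat.sig1 s)).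
  have rv : r = enum_val (tagnat.sig2 s) :> nat.
    rewrite rE vE [LHS]tagnat.rect sum_Erows //; exact: ltnW (ltn_ord _).
  have /rowP/(_ c) := rref_hankel_row le_in rv.
  rewrite !row_entry mxsub_entry => ->; congr (N _ _).
  by apply: ord_inj; rewrite val_widen Rank_block -[in LHS](tagnat.sig2K c) Rank_block.
rewrite col_mxEd [RHS]mxE -row_entry.
have /eqP-> : row r (rref (hankel D i)) == 0; last by rewrite mxE.
rewrite -[_ == _]negbK row_neq0_pivot -rref_ltn_rank // AE -leqNgt.
by rewrite -/(hrank D i) -sumE rE leq_addr.
Qed.

(** The pivot columns of these rows lie in column block [k] and form an identity matrix there. This
    lets inclusions of row spaces bound the heights. *)
Lemma rank_Eblock (k : 'I_n) : \rank (Eblock D k) = Erows D k.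
Proof.
have [rN _] := rrefP (hankel D n).
have piv (a : 'I_(Erows D k)) : {b : 'I_m | is_pivot N (enum_val a) (tagnat.Rank k b)}.
  apply/sigW; have := enum_valP a; rewrite inE => /existsP[c].
  elim/block_ind: c => k' b; rewrite tagnat.Rank1K => /andP[pc /eqP k'k].
  by subst k'; exists b.
apply: (rank_colsub1 (g := fun a => sval (piv a))).
apply/matrixP => a b; rewrite !mxsub_entry (rref_pivot_col rN (svalP (piv b))).
by rewrite (inj_eq enum_val_inj) mxE.
Qed.

Lemma Eblock_sub (i j : 'I_n) : j = i.+1 :> nat -> (Eblock D i <= Eblock D j)%MS.
Proof.
case: j => j lt_j /= ji; subst j.
have [rM ME] := rref_hankel_leading (ltn_ord i).
have [rM' ME'] := rref_hankel_leading lt_j.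
set M := colsub _ N in rM ME; set M' := colsub _ N in rM' ME'.
apply/row_subP => a; set r : 'I_(\sum_(k < n) m) := enum_val a.
have := enum_valP a; rewrite -/r inE => /existsP[c /andP[/pivotP[_ lt0] /eqP ci]].
have [w' w'D [w'0 w'S]] : exists2 w' : 'rV_(\sum_(k < i.+2) m), (w' <= hankel D i.+2)%MS &
    (forall d : 'I_(\sum_(k < i.+2) m), (d < m)%N -> w' 0 d = 0) /\
    (forall (d : 'I_(\sum_(k < i.+1) m)) (d' : 'I_(\sum_(k < i.+2) m)),
       d' = (m + d)%N :> nat -> w' 0 d' = row r M 0 d).
  by apply: hankel_shift; rewrite -ME row_sub.
(* The first block is the inserted zero block; the shifted blocks after it hold entries of row [r]
   left of its pivot, which lies in block [i]. *)
have w'lead (d : 'I_(\sum_(k < i.+2) m)) : (tagnat.sig1 d < i.+1)%N -> w' 0 d = 0.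
  rewrite sig1_ltn => di; case: (ltnP d m) => [/w'0//|md].
  have dm : (d - m < \sum_(k < i.+1) m)%N by apply: leq_ltn_trans (leq_subr _ _) di.
  rewrite (w'S (Ordinal dm)) /= ?subnKC // row_entry mxsub_entry lt0 //=.
  have : ~~ (c < \sum_(k < i) m)%N by rewrite -sig1_ltn ci ltnn.
  rewrite -leqNgt; apply: leq_trans; rewrite ltn_subLR //.
  by apply: leq_trans di _; rewrite !sum_block mulSn.
have [u w'E] : exists u, w' = u *m M' by apply/submxP; rewrite ME'.
(* The coefficient of a row is the entry of [w'] at its pivot, which is zero before the last
   block. *)
have u0 s d : is_pivot M' s d -> (tagnat.sig1 d < i.+1)%N -> u 0 s = 0.
  by move=> psd /w'lead; rewrite w'E (rref_coord rM' u psd).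
have NM' s b : submxrow N (Ordinal lt_j) s b = M' s (tagnat.Rank ord_max b).
  rewrite !mxsub_entry; congr (N s _); apply: ord_inj.
  by rewrite val_widen !Rank_block.
(* The last block of [w'] is row [a] of [Eblock D i]; compare it with the last block of
   [u *m M']. *)
have -> : row a (Eblock D i) = \sum_s u 0 s *: row s (submxrow N (Ordinal lt_j)).
  apply/rowP => b; rewrite row_entry !mxsub_entry -/r summxE.
  transitivity (w' 0 (tagnat.Rank ord_max b)).
    rewrite (w'S (tagnat.Rank ord_max b)); last by rewrite !Rank_block mulSn addnA.
    rewrite row_entry mxsub_entry; congr (N r _); apply: ord_inj.
    by rewrite val_widen !Rank_block.
  rewrite w'E mxE; apply: eq_bigr => s _.
  by rewrite [RHS]mxE row_entry NM'.
apply: summx_sub => s _.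
(* Rows with pivot in the last block belong to the target; of the others, those that vanish in [M']
   contribute nothing and the rest have coefficient zero. *)
case: (boolP (s \in pivot_rows N (Ordinal lt_j))) => [sj|].
  apply: scalemx_sub.
  have -> : row s (submxrow N (Ordinal lt_j))
            = row (enum_rank_in sj s) (Eblock D (Ordinal lt_j)).
    by apply/rowP => b; rewrite !row_entry !mxsub_entry enum_rankK_in.
  exact: row_sub.
rewrite inE => nsj; have [sM'0|] := eqVneq (row s M') 0.
  have -> : row s (submxrow N (Ordinal lt_j)) = 0; last by rewrite scaler0 sub0mx.
  apply/rowP => b; rewrite row_entry NM' -row_entry sM'0.
  by rewrite !mxE.
rewrite row_neq0_pivot => /existsP[d psd].
rewrite (u0 _ _ psd) ?scale0r ?sub0mx //.
have := ltn_ord (tagnat.sig1 d); rewrite ltnS leq_eqVlt => /orP[/eqP dj|//].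
case/existsP: nsj; exists (widen_ord (leq_block m lt_j) d).
rewrite -pivot_leading psd /=; apply/eqP/ord_inj.
by rewrite sig1_widen dj.
Qed.

End HankelRref.

Theorem lemma5 (R : realType) (n m : nat) (hn : (1 <= n)%N) (hm : (1 <= m)%N)
    (D : nat -> 'M[R]_m) :
  [/\ forall (i : nat) (hi : (i <= n)%N), (1 <= i)%N ->
        block_echelon (rref (hankel D i))
          (fun j : 'I_i => Eblock D (widen_ord hi j)),
      forall i : 'I_n, (Erows D i)%:Z = hrank_diff D i.+1,
      forall i j : 'I_n, j = i.+1 :> nat -> (Eblock D i <= Eblock D j)%MS
    & forall i : nat, (1 <= i < n)%N -> hrank_diff D i <= hrank_diff D i.+1].
Proof.
have ErowsE (i : 'I_n) : (Erows D i)%:Z = hrank_diff D i.+1.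
  rewrite (pivot_rows_interval D i).1 /hrank_diff -subzn ?hrank_leqS //.
  (* The special case of [hrank_diff] at 1 agrees with the general difference because
     [hrank D 0 = 0]. *)
  by case: (i : nat) => //=; rewrite hrank0 subr0.
split=> // [i hi _|i j|i /andP[]].
- exact: rref_hankel_echelon.
- exact: Eblock_sub.
case: i => // i _ lt_in.
rewrite -(ErowsE (Ordinal (ltnW lt_in))) -(ErowsE (Ordinal lt_in)) lez_nat.
(* The smaller height is the rank of its block, which the inclusion bounds by the rank of the next
   block and so by its height. *)
rewrite -rank_Eblock.
by apply: leq_trans (rank_leq_row (Eblock D (Ordinal lt_in))); apply/mxrankS/Eblock_sub.
Qed.
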